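(* Let $u,v$ be Hadamard equivalent but distinct complex Hadamard matrices of the same order $n$, and let $R_u,R_v\subset R$ be the corresponding Hadamard/spin model subfactors. Without loss of generality, suppose that $u=D_1P_1W$ and $v=D_2P_2W$, where $W$ is a complex Hadamard matrix of order $n$, $D_1,D_2$ are diagonal unitary matrices and $P_1,P_2$ are permutation matrices of order $n$. Let $w$ be an arbitrary complex Hadamard matrix of the same order as $u$ and $v$. Then: (i) There exists $\theta\in\mathrm{Aut}(R)$ such that the chains of subfactors $\cdots\subset R_k^{u,w}\subset\cdots\subset R_0^{u,w}\subset R_u\subset R$ and $\cdots\subset R_k^{v,w}\subset\cdots\subset R_0^{v,w}\subset R_v\subset R$ are isomorphic, that is, $\theta(R_u)=R_v$ and $\theta(R_k^{u,w})=R_k^{v,w}$ for all $k\in\mathbb{N}\cup\{0\}$. (ii) Furthermore, the automorphism $\theta$ is outer if and only if $P_1\neq P_2$, in which case the outer period equals the order of the permutation $P_2P_1^*$.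
   Context: Here $n\ge2$. $M_n$ denotes complex $n\times n$ matrices with matrix units $E_{ij}$, $\Delta_n\subset M_n$ the diagonal matrices, $I_n$ the identity, $M_n^{(k)}=M_n^{\otimes k}$ ($M_n^{(0)}=\mathbb{C}$), $I_n^{(k)}$ its identity, $\mathrm{Ad}_x(y)=xyx^*$. $M_n^{(k)}$ is embedded in $M_n^{(k+1)}$ by $x\mapsto I_n\otimes x$; $R$ is the hyperfinite $II_1$ factor obtained as the strong closure of $\bigcup_kM_n^{(k)}$ in the GNS representation of its unique normalized trace. A complex Hadamard matrix of order $n$ is a unitary in $M_n$ all of whose entries have modulus $1/\sqrt n$. Two such matrices $H_1,H_2$ are Hadamard equivalent if $H_1=DPH_2P'D'$ for some diagonal unitary matrices $D,D'$ and permutation matrices $P,P'$. For a complex Hadamard matrix $u$ put $D_u=\sqrt n\sum_{i,j}\overline{u_{ij}}(E_{ii}\otimes E_{jj})$, $u_0=u$, $u_{2k+1}=(I_n\otimes u_{2k})(D_u\otimes I_n^{(k)})\in M_n^{(k+2)}$ for $k\ge0$, and $u_{2k}=u_{2k-1}(u\otimes I_n^{(k)})\in M_n^{(k+1)}$ for $k\ge1$. Projections: $e_1=\frac1n\sum_{i,j}E_{ij}$, $e_2=\sum_iE_{ii}\otimes E_{ii}$, $e_{2k+1}=e_1\otimes I_n^{(k)}$, $e_{2k+2}=e_2\otimes I_n^{(k)}$ for $k\ge1$. The Hadamard (spin model) subfactor $R_u\subset R$ is the von Neumann algebra generated by $u\Delta_nu^*$ and $\{e_j:j\ge2\}$. For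 complex Hadamard matrices $u,w$ of order $n$ put $N^{u,w}_{2k}=\mathrm{Ad}_{u_{2k+1}(I_n\otimes w_{2k})}(I_n\otimes\Delta_n\otimes I_n^{(k)})\subset M_n^{(k+2)}$; the vertex model subfactor $R_k^{u,w}\subset R$ is the von Neumann algebra generated by $N^{u,w}_{2k}$ and $\{e_{2k+2+i}:i\ge1\}$. An automorphism of $R$ is outer if it is not inner. The outer period of $\alpha\in\mathrm{Aut}(R)$ is the $p_0\in\mathbb{N}$ with $\{j\in\mathbb{Z}:\alpha^j\text{ inner}\}=p_0\mathbb{Z}$, and is $0$ if there is no such $p_0\in\mathbb{N}$. *)

(* Defs.v *)
From HB Require Import structures.
From mathcomp Require Import all_boot all_order all_fingroup all_algebra.
From mathcomp Require Import complex mxtens.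
From mathcomp Require Import all_classical all_reals all_analysis.

Set Implicit Arguments.
Unset Strict Implicit.
Unset Printing Implicit Defensive.

Import Order.TTheory GRing.Theory Num.Theory Num.Def.
Import numFieldNormedType.Exports.

Local Open Scope classical_set_scope.
Local Open Scope ring_scope.
Local Open Scope sesquilinear_scope.

(** * Matrices *)

(* The size n ^ k of the matrices in M_n^{(k)}; unlike with [n ^ k],
   [tdim n k.+1] is convertible to [n * tdim n k], so that no casts are needed.
   A tensor product of matrices is the Kronecker product [*t] of mxtens. *)
Fixpoint tdim (n k : nat) : nat := if k is k'.+1 then (n * tdim n k')%N else 1%N.

Section Matrices.
Variables (K : realType) (n : nat).
Local Notation C := (complex K).
Local Notation "''T_' k" := 'M[C]_(tdim n k) (at level 8, k at level 2).

Definition complex_hadamard (u : 'M[C]_n) : Prop :=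
  u \is unitarymx /\ forall i j, `|u i j| = (sqrtC n%:R)^-1.

Definition diag_unitary (D : 'M[C]_n) : Prop :=
  is_diag_mx D /\ D \is unitarymx.

Definition hadamard_equiv (u v : 'M[C]_n) : Prop :=
  exists D P P' D' : 'M[C]_n,
    [/\ diag_unitary D, diag_unitary D', is_perm_mx P, is_perm_mx P'
      & u = D *m P *m v *m P' *m D'].

Definition emb k (x : 'T_k) : 'T_(k.+1) := 1%:M *t x.

Definition first_leg k (a : 'M[C]_n) : 'T_(k.+1) := a *t (1%:M : 'T_k).

(* D_u (x) I_n^{(k)} *)
Definition hadD (u : 'M[C]_n) k : 'T_(k.+2) :=
  sqrtC n%:R *: \sum_(i < n) \sum_(j < n)
    (u i j)^* *: (delta_mx i i *t first_leg k (delta_mx j j)).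

(* [had_even u k] is u_{2k} and [had_odd u k] is u_{2k+1}; see [had_evenS]. *)
Fixpoint had_even (u : 'M[C]_n) k : 'T_(k.+1) :=
  if k is k'.+1 then emb (had_even u k') *m hadD u k' *m first_leg k'.+1 u
  else first_leg 0 u.

Definition had_odd (u : 'M[C]_n) k : 'T_(k.+2) := emb (had_even u k) *m hadD u k.

Lemma had_evenS u k : had_even u k.+1 = had_odd u k *m first_leg k.+1 u.
Proof. by []. Qed.

(* [jones_odd k] is e_{2k+1} and [jones_even k] is e_{2k+2}. *)
Definition jones_odd k : 'T_(k.+1) := first_leg k (n%:R^-1 *: const_mx 1).

Definition jones_even k : 'T_(k.+2) :=
  \sum_(i < n) delta_mx i i *t first_leg k (delta_mx i i).

(* u Delta_n u^*, as a subset of M_n^{(1)} *)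
Definition spin_diag (u : 'M[C]_n) : set 'T_1 :=
  [set first_leg 0 (u *m d *m u ^t*) | d in [set d : 'M[C]_n | is_diag_mx d]].

(* N_{2k}^{u,w} *)
Definition vertex_diag (u w : 'M[C]_n) k : set 'T_(k.+2) :=
  let x := had_odd u k *m emb (had_even w k) in
  [set x *m emb (first_leg k d) *m x ^t*
    | d in [set d : 'M[C]_n | is_diag_mx d]].

End Matrices.

Arguments vertex_diag {K n} u w k.

(** * Hilbert spaces and von Neumann algebras *)

(* The inner product is linear in its first argument. *)
Record hilbert (K : realType) := Hilbert {
  hspace :> completeNormedModType (complex K);
  inner_prod : {dot hspace for (@conjC (complex K))};
  inner_prod_norm : forall x : hspace, `|x| ^+ 2 = inner_prod x x }.

Section Operators.
Variables (K : realType) (H : hilbert K).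
Local Notation C := (complex K).
Implicit Types (S T U V : H -> H) (N : set (H -> H)).

Definition bounded_operators : set (H -> H) :=
  [set T | linear T /\ continuous T].

Definition is_adjoint T S : Prop :=
  forall x y : H, inner_prod H (T x) y = inner_prod H x (S y).

(* The strong operator topology is the topology of pointwise convergence. *)
Definition strong_closure N : set (H -> H) :=
  bounded_operators `&` @closure {ptws H -> H} N.

Record vn_algebra N : Prop := VNAlgebra {
  vn_bounded : N `<=` bounded_operators;
  vn_id : N idfun;
  vn_add : forall T S, N T -> N S -> N (T + S);
  vn_scale : forall (a : C) T, N T -> N (a *: T);
  vn_comp : forall T S, N T -> N S -> N (T \o S);
  vn_adjoint : forall T S, N T -> is_adjoint T S -> N S;
  vn_closed : strong_closure N `<=` N }.

Definition vn_generated (A : set (H -> H)) : set (H -> H) :=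
  smallest vn_algebra A.

(* *-automorphisms of N; only the values on N of [aut] and [aut_inv] matter. *)
Record automorphism N := Automorphism {
  aut :> (H -> H) -> (H -> H);
  aut_inv : (H -> H) -> (H -> H);
  aut_in : forall T, N T -> N (aut T);
  aut_inv_in : forall T, N T -> N (aut_inv T);
  autK : forall T, N T -> aut_inv (aut T) = T;
  aut_invK : forall T, N T -> aut (aut_inv T) = T;
  aut_add : forall T S, N T -> N S -> aut (T + S) = aut T + aut S;
  aut_scale : forall (a : C) T, N T -> aut (a *: T) = a *: aut T;
  aut_comp : forall T S, N T -> N S -> aut (T \o S) = aut T \o aut S;
  aut_adjoint : forall T S, N T -> N S -> is_adjoint T S ->
    is_adjoint (aut T) (aut S) }.

Definition aut_pow N (f : automorphism N) (j : int) : (H -> H) -> (H -> H) :=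
  match j with
  | Posz m => iter m f
  | Negz m => iter m.+1 (aut_inv f)
  end.

(* V below is the adjoint of U, so f is Ad_U for a unitary U in N. *)
Definition inner N (f : (H -> H) -> (H -> H)) : Prop :=
  exists U V, [/\ N U, is_adjoint U V, U \o V = idfun, V \o U = idfun
    & forall T, N T -> f T = U \o T \o V].

Definition outer N (f : automorphism N) : Prop := ~ inner N f.

Definition outer_period N (f : automorphism N) : nat :=
  xget 0%N [set p : nat | (0 < p)%N /\
    [set j : int | inner N (aut_pow f j)] = range (fun m : int => p%:Z * m)].

End Operators.

(** * The hyperfinite II_1 factor and its subfactors *)

(* A GNS representation of the normalized trace on the union of the M_n^{(k)},
   given by compatible representations of the M_n^{(k)} with a common cyclic
   vector; it is unique up to unitary equivalence. *)
Record gns (K : realType) (n : nat) (H : hilbert K) := GNS {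
  rep : forall k, 'M[complex K]_(tdim n k) -> H -> H;
  rep_bounded : forall k x, bounded_operators (@rep k x);
  rep_add : forall k x y, @rep k (x + y) = @rep k x + @rep k y;
  rep_scale : forall k a x, @rep k (a *: x) = a *: @rep k x;
  rep_mul : forall k x y, @rep k (x *m y) = @rep k x \o @rep k y;
  rep_one : forall k, @rep k 1%:M = idfun;
  rep_adjoint : forall k x, is_adjoint (@rep k x) (@rep k (x ^t*));
  rep_emb : forall k x, @rep k.+1 (emb x) = @rep k x;
  cyclic_vector : H;
  rep_trace : forall k x,
    inner_prod H (@rep k x cyclic_vector) cyclic_vector =
      \tr x / (tdim n k)%:R;
  rep_cyclic :
    closure [set z : H | exists k x, z = @rep k x cyclic_vector] = setT }.

Arguments rep {K n H} g k x.

Section Subfactors.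
Variables (K : realType) (n : nat) (H : hilbert K) (G : gns n H).
Implicit Types u w : 'M[complex K]_n.

Definition hyperfinite : set (H -> H) :=
  strong_closure (\bigcup_k range (rep G k)).

(* The operator e_j, for j >= 1 *)
Definition jones (j : nat) : H -> H :=
  if odd j then rep G _ (jones_odd K n j./2)
  else rep G _ (jones_even K n j./2.-1).

Definition spin_subfactor u : set (H -> H) :=
  vn_generated (rep G 1 @` spin_diag u `|`
                jones @` [set j | (2 <= j)%N]).

Definition vertex_subfactor u w k : set (H -> H) :=
  vn_generated (rep G k.+2 @` vertex_diag u w k `|`
                [set jones (2 * k + 2 + i)%N | i in [set i | (1 <= i)%N]]).

End Subfactors.

(* Main.v *)
Require Import Defs.
From HB Require Import structures.
From mathcomp Require Import all_boot all_order all_fingroup all_algebra.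
From mathcomp Require Import cyclic complex mxtens.
From mathcomp Require Import all_classical all_reals all_analysis.
Import Order.TTheory GRing.Theory Num.Theory Num.Def.
Import numFieldNormedType.Exports.
Local Open Scope classical_set_scope.
Local Open Scope ring_scope.
Local Open Scope sesquilinear_scope.

Set Implicit Arguments.
Unset Strict Implicit.
Unset Printing Implicit Defensive.

(** Write [v = D P u] with [P = P2 P1^*] a permutation matrix and [D] a
    diagonal unitary, and put [Q = D P].  An induction on the level gives
      v_{2k} = (P (x) ... (x) P (x) Q) u_{2k}   and
      v_{2k+1} = (P (x) ... (x) P (x) Q) u_{2k+1} (Q^* (x) I),
    so the infinite product automorphism [... (x) Ad_P (x) Ad_P (x) Ad_Q] maps
    the generators of the subfactors of [u] to those of the subfactors of [v].
    It preserves the trace, hence is implemented on the GNS space by a unitary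
    which extends [x Omega |-> Ad(x) Omega].

    Its [j]-th power is the infinite product of [Ad_{P^j}] up to the last leg.
    If [P^j = 1] it is inner, implemented by a unitary of M_n^{(1)}.  If it is
    [Ad_U] with [U] in [R], then [U] is 2-norm close to some [x] in M_n^{(k)},
    and [x] commutes with the new leg of M_n^{(k+1)}; so [U c = (P^j c P^{-j}) U]
    on that leg gives [||(c - P^j c P^{-j}) (x) x||_2] small, which is absurd
    when [P^j] does not commute with the diagonal unitary [c]. *)

(** * Isometries and pointwise convergence *)

(** The family [p] indexes a dense set, with repetitions allowed. Equality of distances makes [q]
    well defined and uniformly continuous on it, and completeness of the target does the rest. *)
Lemma isometry_extension (F : numFieldType) (V W : completeNormedModType F)
    (X : Type) (p : X -> V) (q : X -> W) :
  (forall x y, `|q x - q y| = `|p x - p y|) ->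
  closure (range p) = setT ->
  exists U : V -> W, (forall x, U (p x) = q x) /\
    (forall a b, `|U a - U b| = `|a - b|).
Proof.
move=> pq pD.
(* Along this filter on the indices, [p] tends to [a]; the extension at [a] is the limit of [q]
   along it. *)
pose G (a : V) : set_system X :=
  filter_from [set e : F | 0 < e] (fun e => p @^-1` ball a e).
have Gp (a : V) : ProperFilter (G a).
  apply: filter_from_proper; last first.
    move=> e /= e0; have : closure (range p) a by rewrite pD.
    move=> /(_ (ball a e) (nbhsx_ballx _ _ e0)) [_ [[x _ <-] xe]].
    by exists x.
  apply: filter_from_filter; first by exists 1; rewrite /= ltr01.
  move=> e f /= e0 f0.
  have /orP[ef|ef] : (e <= f) || (f <= e) by rewrite real_leVge ?gtr0_real.
    exists e => // x /= xe; split => //; exact: le_ball xe.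
  by exists f => // x /= xf; split => //; exact: le_ball xf.
have pG (a : V) : p @ G a --> a.
  by apply/cvg_ballP => e e0; exists e.
have qG (a : V) : cvg (q @ G a).
  apply/cauchy_cvgP/cauchy_ballP => e e0.
  near_simpl; rewrite /=.
  exists (p @^-1` ball a (e / 2), p @^-1` ball a (e / 2)).
    by split; exists (e / 2); rewrite /= ?divr_gt0.
  move=> [x y] [] /=; rewrite -!ball_normE /= pq => xe ye.
  rewrite (splitr e) -(subrKA a).
  by rewrite (le_lt_trans (ler_normD _ _)) // ltrD // distrC.
exists (fun a => lim (q @ G a)).
have Ux a y : `|lim (q @ G a) - q y| = `|a - p y|.
  have h1 : `|q x - q y| @[x --> G a] --> `|lim (q @ G a) - q y|.
    by apply: cvg_norm; apply: cvgB; [exact: qG | exact: cvg_cst].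
  have h2 : `|q x - q y| @[x --> G a] --> `|a - p y|.
    under eq_fun do rewrite pq.
    by apply: cvg_norm; apply: cvgB; [exact: pG | exact: cvg_cst].
  exact: (cvg_unique _ h1 h2).
split=> [x|a b]; first by apply/subr0_eq/normr0_eq0; rewrite Ux subrr normr0.
have h1 : `|lim (q @ G a) - q y| @[y --> G b] --> `|lim (q @ G a) - lim (q @ G b)|.
  by apply: cvg_norm; apply: cvgB; [exact: cvg_cst | exact: qG].
have h2 : `|lim (q @ G a) - q y| @[y --> G b] --> `|a - b|.
  under eq_fun do rewrite Ux.
  by apply: cvg_norm; apply: cvgB; [exact: cvg_cst| exact: pG].
exact: (cvg_unique _ h1 h2).
Unshelve. all: by end_near.
Qed.

Lemma isometry_continuous (F : numFieldType) (V W : normedModType F)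
    (U : V -> W) :
  (forall a b, `|U a - U b| = `|a - b|) -> continuous U.
Proof.
move=> iU a; apply/cvgrPdist_lt => e e0; near=> b.
rewrite iU; near: b; exact: cvgr_dist_lt.
Unshelve. all: by end_near.
Qed.


Lemma eq_on_closure (T Y : topologicalType) (A : set T) (f g : T -> Y) :
  hausdorff_space Y -> continuous f -> continuous g ->
  (forall x, A x -> f x = g x) -> forall x, closure A x -> f x = g x.
Proof.
move=> hY cf cg fg x Ax; apply: hY => B C fB gC.
have nfB : nbhs x (f @^-1` B) := cf x _ fB.
have [y [Ay [By Cy]]] := Ax _ (filterI nfB (cg x _ gC)).
by exists (f y); split => //; rewrite fg.
Qed.

Lemma linear_map0 (F : pzRingType) (V W : lmodType F) (f : V -> W) :
  linear f -> f 0 = 0.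
Proof. by move=> lf; have := lf (-1) 0 0; rewrite scaler0 addr0 scaleN1r addNr. Qed.

Lemma linear_mapD (F : pzRingType) (V W : lmodType F) (f : V -> W) :
  linear f -> forall x y, f (x + y) = f x + f y.
Proof. by move=> lf x y; have := lf 1 x y; rewrite !scale1r. Qed.

Lemma linear_mapZ (F : pzRingType) (V W : lmodType F) (f : V -> W) :
  linear f -> forall a x, f (a *: x) = a *: f x.
Proof. by move=> lf a x; have := lf a x 0; rewrite (linear_map0 lf) !addr0. Qed.

(** [X] carries no vector space structure, so linearity is asked of the pairs [(p x, q x)]: they are
    closed under linear combinations. *)
Lemma isometry_extension_linear (F : numFieldType) (V W : completeNormedModType F)
    (X : Type) (p : X -> V) (q : X -> W) :
  (forall (c : F) x y, exists z, p z = c *: p x + p y /\ q z = c *: q x + q y) ->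
  (forall x, `|q x| = `|p x|) -> closure (range p) = setT ->
  exists U : V -> W, [/\ linear U, forall x, U (p x) = q x &
    forall a, `|U a| = `|a|].
Proof.
move=> lin nrm pD.
have pq x y : `|q x - q y| = `|p x - p y|.
  have [z [pz qz]] := lin (-1) y x.
  by rewrite ![_ - _ y]addrC -(scaleN1r (q y)) -(scaleN1r (p y)) -pz -qz nrm.
have [U [Up iU]] := isometry_extension pq pD.
have cU : continuous U by exact: isometry_continuous.
have eqD (f g : V -> W) : continuous f -> continuous g ->
    (forall x, f (p x) = g (p x)) -> forall a, f a = g a.
  move=> cf cg fg a; apply: (@eq_on_closure _ _ (range p)) => //.
  - by move=> _ [x _ <-].
  - by rewrite pD.
have lU : linear U.
  (* Density is used once in each variable: first to replace [a] by [p x], then [b] by [p y]. *)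
  move=> c a b; apply: (eqD (fun a => U (c *: a + b)) (fun a => c *: U a + U b)).
  - move=> x; apply: continuous_comp; last exact: cU.
    by apply: cvgD; [apply: cvgZl_tmp; exact: cvg_id|exact: cvg_cst].
  - by move=> x; apply: cvgD; [apply: cvgZl_tmp; exact: cU|exact: cvg_cst].
  move=> x; apply: (eqD (fun b => U (c *: p x + b)) (fun b => c *: U (p x) + U b)).
  - move=> y; apply: continuous_comp; last exact: cU.
    by apply: cvgD; [exact: cvg_cst|exact: cvg_id].
  - by move=> y; apply: cvgD; [exact: cvg_cst|exact: cU].
  by move=> y; have [z [pz qz]] := lin c x y; rewrite -pz !Up qz.
exists U; split => // a.
by rewrite -[U a]subr0 -(linear_map0 lU) iU subr0.
Qed.

Lemma ptws_continuous (T X : topologicalType) (Y : uniformType)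
    (F : T -> {ptws X -> Y}) :
  (forall x, continuous (fun t => F t x)) -> continuous F.
Proof.
move=> cF t; have FF : Filter (F @ t) := fmap_filter _ (nbhs_filter t).
by have := (pointwise_cvgP (F t) FF).2; apply => x; exact: cF.
Qed.

(** * Operators conjugated by a unitary *)

Section Operators.
Variables (K : realType) (H : hilbert K).
Local Notation C := (complex K).
Implicit Types (S T U V : H -> H) (N M : set (H -> H)).
Local Notation "<[ x , y ]>" := (inner_prod H x y).

Lemma inner_prodC (x y : H) : <[x, y]> = (<[y, x]>)^*.
Proof. by rewrite hermC expr0 mul1r. Qed.

Lemma inner_prodZr (a : C) (x y : H) : <[x, a *: y]> = a^* * <[x, y]>.
Proof. by rewrite linearZ. Qed.

Lemma is_adjoint_sym T S : is_adjoint T S -> is_adjoint S T.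
Proof. by move=> TS x y; rewrite inner_prodC -TS -inner_prodC. Qed.

(** Polarization: the norms of sums determine the real parts of inner products. *)
Lemma linear_isometry_inner U : linear U -> (forall x, `|U x| = `|x|) ->
  forall x y, <[U x, U y]> = <[x, y]>.
Proof.
move=> lU iU.
have sq x : <[U x, U x]> = <[x, x]> by rewrite -!inner_prod_norm iU.
have re x y : <[U x, U y]> + (<[U x, U y]>)^* = <[x, y]> + (<[x, y]>)^*.
  by have := sq (x + y); rewrite (linear_mapD lU) !dnormD !sq => /addrI.
move=> x y.
(* Replacing y by iy turns real parts into imaginary parts. *)
have := re x ('i *: y); rewrite (linear_mapZ lU) !inner_prodZr !rmorphM /= conjCK conjCi.
rewrite !mulNr -!mulrN -!mulrDr => /(mulfI (neq0Ci _)) im.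
have : (<[U x, U y]>) *+ 2 = (<[x, y]>) *+ 2.
  rewrite !mulr2n; have := congr2 (fun a b => a - b) (re x y) im => /=.
  by rewrite !opprD !opprK !addrA ![_ + _ + <[_, _]>]addrAC !addrK.
by move/(pmulrnI (isT : (0 < 2)%N)).
Qed.

Definition unitary_pair U V := [/\ bounded_operators U, bounded_operators V,
  is_adjoint U V, U \o V = idfun & V \o U = idfun].

Lemma unitary_pair_sym U V : unitary_pair U V -> unitary_pair V U.
Proof. by move=> [bU bV UV UVK VUK]; split => //; exact: is_adjoint_sym. Qed.

Definition conj_op U V T := U \o T \o V.

Lemma conj_opK U V T : V \o U = idfun -> conj_op V U (conj_op U V T) = T.
Proof.
move=> VU; rewrite /conj_op; apply/funext => x /=.
by have := congr1 (@^~ x) VU => /= ->; have := congr1 (@^~ (T x)) VU => /= ->.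
Qed.

Lemma bounded_comp T S :
  bounded_operators T -> bounded_operators S -> bounded_operators (T \o S).
Proof.
move=> [lT cT] [lS cS]; split; first by move=> a x y /=; rewrite lS lT.
by move=> x; apply: continuous_comp; [exact: cS|exact: cT].
Qed.

Lemma bounded_conj U V T : bounded_operators U -> bounded_operators V ->
  bounded_operators T -> bounded_operators (conj_op U V T).
Proof. by move=> bU bV bT; do 2?[apply: bounded_comp => //]. Qed.

Lemma ptws_eval_continuous (x : H) :
  continuous (fun T : {ptws H -> H} => T x : H).
Proof. exact: (@proj_continuous H (fun=> H) x). Qed.

(** Evaluated at [x], the conjugate of [T] is [U (T (V x))], so continuity of [U] suffices. *)
Lemma conj_op_continuous U V : continuous U ->
  continuous (conj_op U V : {ptws H -> H} -> {ptws H -> H}).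
Proof.
move=> cU; apply: ptws_continuous => x.
move=> T; apply: (@continuous_comp _ _ _ (fun S : {ptws H -> H} => S (V x)) U); last exact: cU.
exact: ptws_eval_continuous.
Qed.

Lemma strong_closure_conj U V N T : bounded_operators U -> bounded_operators V ->
  strong_closure N T -> strong_closure (conj_op U V @` N) (conj_op U V T).
Proof.
move=> bU bV [bT clT]; split; first exact: bounded_conj.
move=> B FB.
have /clT [S [NS BS]] : nbhs (T : {ptws H -> H}) (conj_op U V @^-1` B).
  exact: (@conj_op_continuous U V bU.2 T).
by exists (conj_op U V S); split => //; exists S.
Qed.

Lemma strong_closureS N M : N `<=` M -> strong_closure N `<=` strong_closure M.
Proof. by move=> NM T [bT cT]; split => //; exact: (@closureS {ptws H -> H} N M NM). Qed.

Lemma strong_closure_eq U V U' V' N :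
  continuous U -> continuous U' ->
  (forall T, N T -> conj_op U V T = conj_op U' V' T) ->
  forall T, strong_closure N T -> conj_op U V T = conj_op U' V' T.
Proof.
move=> cU cU' E T [_ clT]; apply/funext => x.
pose ev (T : {ptws H -> H}) : H := T x.
apply: (@eq_on_closure {ptws H -> H} H N (fun T => ev (conj_op U V T))
  (fun T => ev (conj_op U' V' T))) => //.
- move=> S; apply: (@continuous_comp _ _ _ (conj_op U V : {ptws H -> H} -> {ptws H -> H}) ev).
    exact: conj_op_continuous.
  exact: ptws_eval_continuous.
- move=> S; apply: (@continuous_comp _ _ _ (conj_op U' V' : {ptws H -> H} -> {ptws H -> H}) ev).
    exact: conj_op_continuous.
  exact: ptws_eval_continuous.
- by move=> S NS; rewrite E.
Qed.

Section Spatial.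
Variables U V : H -> H.
Hypothesis UV : unitary_pair U V.

Let lU : linear U. Proof. by case: UV => -[]. Qed.
Let VK x : U (V x) = x. Proof. by case: UV => _ _ _ /(congr1 (@^~ x)). Qed.
Let UK x : V (U x) = x. Proof. by case: UV => _ _ _ _ /(congr1 (@^~ x)). Qed.

Lemma conj_opD T S : conj_op U V (T + S) = conj_op U V T + conj_op U V S.
Proof.
by apply/funext => x; exact: linear_mapD.
Qed.

Lemma conj_opZ (a : C) T : conj_op U V (a *: T) = a *: conj_op U V T.
Proof.
by apply/funext => x; exact: linear_mapZ.
Qed.

Lemma conj_opM T S : conj_op U V (T \o S) = conj_op U V T \o conj_op U V S.
Proof. by apply/funext => x; rewrite /conj_op /= UK. Qed.

Lemma conj_op_adjoint T S :
  is_adjoint T S -> is_adjoint (conj_op U V T) (conj_op U V S).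
Proof.
case: UV => _ _ aUV _ _ TS x y.
by rewrite /conj_op /= aUV TS (is_adjoint_sym aUV).
Qed.

End Spatial.

Lemma conj_op_image U V N M : unitary_pair U V ->
  (forall T, N T -> M (conj_op U V T)) ->
  (forall T, M T -> N (conj_op V U T)) -> conj_op U V @` N = M.
Proof.
move=> [_ _ _ UV VU] NM MN; rewrite eqEsubset; split => [_ [T NT <-]|T MT]; first exact: NM.
by exists (conj_op V U T); [exact: MN|exact: conj_opK].
Qed.

(** Taking preimages rather than images lets the minimality of a generated algebra be applied
    directly. *)
Lemma vn_algebra_preimage U V N : unitary_pair U V -> vn_algebra N ->
  vn_algebra (conj_op U V @^-1` N).
Proof.
move=> uUV vN; have [bU bV aUV UVK VUK] := uUV.
split.
- move=> T /= /(vn_bounded vN) bT; rewrite -(conj_opK T VUK).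
  exact: bounded_conj.
- by have := vn_id vN; rewrite -[idfun in X in X -> _]UVK.
- by move=> T S /= NT NS; rewrite conj_opD //; exact: (vn_add vN).
- by move=> a T /= NT; rewrite conj_opZ //; exact: (vn_scale vN).
- by move=> T S /= NT NS; rewrite conj_opM //; exact: (vn_comp vN).
- by move=> T S /= NT TS; apply: (vn_adjoint vN NT); exact: conj_op_adjoint.
- move=> T clT; apply: (vn_closed vN).
  apply: strong_closureS (strong_closure_conj bU bV clT).
  by move=> _ [S NS <-].
Qed.

Lemma vn_generated_conj U V (A B : set (H -> H)) : unitary_pair U V ->
  (forall T, A T -> B (conj_op U V T)) -> forall T, vn_generated A T ->
  vn_generated B (conj_op U V T).
Proof.
move=> uUV AB T gT M [vM BM]; apply: (gT (conj_op U V @^-1` M)); split.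
  exact: vn_algebra_preimage.
by move=> S /AB; exact: BM.
Qed.

Lemma conj_op_vn_generated U V (A B : set (H -> H)) : unitary_pair U V ->
  conj_op U V @` A = B ->
  conj_op U V @` vn_generated A = vn_generated B.
Proof.
move=> uUV AB; apply: conj_op_image => //; apply: vn_generated_conj => //.
- by move=> T AT; rewrite -AB; exists T.
- exact: unitary_pair_sym.
- move=> T; rewrite -AB => -[S AS <-]; rewrite conj_opK //.
  by case: uUV.
Qed.

Definition spatial_automorphism U V N (uUV : unitary_pair U V)
    (NU : forall T, N T -> N (conj_op U V T))
    (NV : forall T, N T -> N (conj_op V U T)) : automorphism N :=
  @Automorphism K H N (conj_op U V) (conj_op V U) NU NV
    (fun T _ => conj_opK T (let: And5 _ _ _ _ e := uUV in e))
    (fun T _ => conj_opK T (let: And5 _ _ _ e _ := uUV in e))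
    (fun T S _ _ => conj_opD uUV T S) (fun a T _ => conj_opZ uUV a T)
    (fun T S _ _ => conj_opM uUV T S)
    (fun T S _ _ => @conj_op_adjoint U V uUV T S).

Lemma iter_conj_op U V m T :
  iter m (conj_op U V) T = conj_op (iter m U) (iter m V) T.
Proof.
elim: m => [//|m IH]; rewrite iterS IH; apply/funext => x.
by rewrite /conj_op /= -iterSr.
Qed.

End Operators.

(** * Product unitaries and Hadamard matrices *)

Section Kronecker.
Variable C : numClosedFieldType.

Lemma tensmx11 m n : (1%:M : 'M[C]_m) *t (1%:M : 'M[C]_n) = 1%:M.
Proof.
apply/matrixP => i j.
case: (mxtens_indexP i) => i0 i1; case: (mxtens_indexP j) => j0 j1.
rewrite tensmxE !mxE (can_eq (@mxtens_indexK _ _)) xpair_eqE.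
by case: eqP; case: eqP; rewrite ?mulr1 ?mulr0.
Qed.

Lemma tensmx_adj m n p q (A : 'M[C]_(m, n)) (B : 'M[C]_(p, q)) :
  (A *t B) ^t* = A ^t* *t B ^t*.
Proof. by rewrite trmx_tens map_mxT. Qed.

Lemma mulmx_adj m n p (A : 'M[C]_(m, n)) (B : 'M[C]_(n, p)) :
  (A *m B) ^t* = B ^t* *m A ^t*.
Proof. by rewrite trmx_mul map_mxM. Qed.

Lemma adjmx1 n : (1%:M : 'M[C]_n) ^t* = 1%:M.
Proof. by rewrite trmx1 map_mx1. Qed.

Lemma unitarymx1 n : (1%:M : 'M[C]_n) \is unitarymx.
Proof. by apply/unitarymxP; rewrite adjmx1 mulmx1. Qed.

(** The factor [f] slides past [e] and [y] and cancels against its adjoint. It will be $Q^*$ on a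
    leg that the unitary of [w] and the diagonal matrix do not touch. *)
Lemma conjmx_commuting n (p o f e y : 'M[C]_n) :
  f *m e = e *m f -> f *m y = y *m f -> f *m f ^t* = 1%:M ->
  p *m o *m f *m e *m y *m (p *m o *m f *m e) ^t* =
  p *m (o *m e *m y *m (o *m e) ^t*) *m p ^t*.
Proof.
move=> fe fy ff; have -> : p *m o *m f *m e = p *m o *m e *m f.
  by rewrite -[LHS]mulmxA fe mulmxA.
rewrite -[_ *m f *m y]mulmxA fy !mulmx_adj !mulmxA.
by rewrite -[_ *m f *m f ^t*]mulmxA ff mulmx1.
Qed.

Lemma tensmxZl m n p q a (A : 'M[C]_(m, n)) (B : 'M[C]_(p, q)) :
  (a *: A) *t B = a *: (A *t B).
Proof. by apply/matrixP => i j; rewrite !mxE mulrA. Qed.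

Lemma mxtrace_tens m n (A : 'M[C]_m) (B : 'M[C]_n) :
  \tr (A *t B) = \tr A * \tr B.
Proof.
rewrite /mxtrace mulr_sum; apply: eq_bigr => i _.
by case: (mxtens_indexP i) => i0 i1; rewrite tensmxE mxtens_indexK.
Qed.

End Kronecker.

(** * Finite product unitaries and their adjoint action *)

Section ProductUnitaries.
Variables (K : realType) (n : nat).
Local Notation C := (complex K).
Local Notation "''T_' k" := 'M[C]_(tdim n k) (at level 8, k at level 2).
Implicit Types (A B : 'M[C]_n).

(* New legs are added on the left, as in [emb]: [A] acts on the first leg. *)
Fixpoint prod_unitary A B k : 'T_k :=
  if k is k'.+1 then (if k' is 0 then A else B) *t prod_unitary A B k'
  else 1%:M.

Lemma prod_unitaryM A B A' B' k :
  prod_unitary A B k *m prod_unitary A' B' k =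
  prod_unitary (A *m A') (B *m B') k.
Proof.
elim: k => [|k IH]; first by rewrite mulmx1.
by rewrite /= tensmx_mul IH; case: k {IH}.
Qed.

Lemma prod_unitary_adj A B k :
  (prod_unitary A B k) ^t* = prod_unitary (A ^t*) (B ^t*) k.
Proof.
elim: k => [|k IH]; first exact: adjmx1.
by rewrite /= tensmx_adj IH; case: k {IH}.
Qed.

Lemma prod_unitary1 k : prod_unitary 1%:M 1%:M k = 1%:M.
Proof.
elim: k => [//|k IH] /=; rewrite IH.
by case: k {IH} => *; exact: tensmx11.
Qed.

Lemma prod_unitaryK A B k : A \is unitarymx -> B \is unitarymx ->
  prod_unitary A B k *m (prod_unitary A B k) ^t* = 1%:M.
Proof.
move=> /unitarymxP uA /unitarymxP uB.
by rewrite prod_unitary_adj prod_unitaryM uA uB prod_unitary1.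
Qed.

Lemma prod_unitary_unitary A B k : A \is unitarymx -> B \is unitarymx ->
  prod_unitary A B k \is unitarymx.
Proof. by move=> uA uB; apply/unitarymxP; exact: prod_unitaryK. Qed.

Definition prod_ad A B k (x : 'T_k) : 'T_k :=
  prod_unitary A B k *m x *m (prod_unitary A B k) ^t*.

Lemma prod_adD A B k (x y : 'T_k) :
  prod_ad A B (x + y) = prod_ad A B x + prod_ad A B y.
Proof. by rewrite /prod_ad mulmxDr mulmxDl. Qed.

Lemma prod_adZ A B k a (x : 'T_k) : prod_ad A B (a *: x) = a *: prod_ad A B x.
Proof. by rewrite /prod_ad -scalemxAr -scalemxAl. Qed.

Lemma prod_ad_comp A B A' B' k (x : 'T_k) :
  prod_ad A B (prod_ad A' B' x) = prod_ad (A *m A') (B *m B') x.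
Proof. by rewrite /prod_ad -prod_unitaryM mulmx_adj !mulmxA. Qed.

Lemma prod_ad1 k (x : 'T_k) : prod_ad 1%:M 1%:M x = x.
Proof. by rewrite /prod_ad prod_unitary1 adjmx1 mul1mx mulmx1. Qed.

Lemma prod_adM A B k (x y : 'T_k) : A \is unitarymx -> B \is unitarymx ->
  prod_ad A B (x *m y) = prod_ad A B x *m prod_ad A B y.
Proof.
by move=> uA uB; rewrite /prod_ad !mulmxA mulmxKtV ?prod_unitary_unitary.
Qed.

Lemma prod_ad_adj A B k (x : 'T_k) : (prod_ad A B x) ^t* = prod_ad A B (x ^t*).
Proof. by rewrite /prod_ad !mulmx_adj trmxCK mulmxA. Qed.

(** On the added leg the unitary only conjugates the identity, so the maps of all levels fit
    together on the union. *)
Lemma prod_ad_emb A B k (x : 'T_k) : A \is unitarymx -> B \is unitarymx ->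
  prod_ad A B (emb x) = emb (prod_ad A B x).
Proof.
move=> uA uB; rewrite /prod_ad /emb /= tensmx_adj !tensmx_mul mulmx1.
by congr (_ *t _); case: k x => *; apply/unitarymxP.
Qed.

(** At this level the added leg is not the first one, hence carries [B]. *)
Lemma prod_ad_top A B k c : A \is unitarymx -> B \is unitarymx ->
  prod_ad A B (first_leg k.+1 c) = first_leg k.+1 (B *m c *m B ^t*).
Proof.
move=> uA uB; have pE : prod_unitary A B k.+2 = B *t prod_unitary A B k.+1 by [].
rewrite /prod_ad /first_leg pE tensmx_adj !tensmx_mul mulmx1.
by congr (_ *t _); exact: (prod_unitaryK k.+1).
Qed.

Lemma prod_ad_tr A B k (x : 'T_k) : A \is unitarymx -> B \is unitarymx ->
  \tr (prod_ad A B x) = \tr x.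
Proof.
move=> uA uB; rewrite /prod_ad mxtrace_mulC mulmxA.
by rewrite (mulmx1C (prod_unitaryK _ uA uB)) mul1mx.
Qed.

End ProductUnitaries.

Arguments prod_ad {K n} A B {k} x.

(** * Monomial matrices acting on the Hadamard unitaries and Jones projections *)

Section MonomialMatrices.
Variables (K : realType) (n : nat).
Local Notation C := (complex K).
Implicit Types (d e : 'rV[C]_n) (s : 'S_n) (u w c : 'M[C]_n).

Definition monomial_mx d s : 'M[C]_n := diag_mx d *m perm_mx s.

Lemma monomial_mx1 s : monomial_mx (const_mx 1) s = perm_mx s.
Proof. by rewrite /monomial_mx diag_const_mx mul1mx. Qed.

Lemma adj_perm_mx s : (perm_mx s : 'M[C]_n) ^t* = perm_mx (s^-1)%g.
Proof. by rewrite tr_perm_mx map_perm_mx. Qed.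

Lemma unitary_perm_mx s : (perm_mx s : 'M[C]_n) \is unitarymx.
Proof. by apply/unitarymxP; rewrite adj_perm_mx -perm_mxM mulgV perm_mx1. Qed.

Lemma adj_delta_mx (i j : 'I_n) : (delta_mx i j : 'M[C]_n) ^t* = delta_mx j i.
Proof. by rewrite trmx_delta map_delta_mx. Qed.

Lemma mul_monomial_delta d s (i j : 'I_n) :
  monomial_mx d s *m delta_mx (s i) j = d 0 i *: delta_mx i j.
Proof.
rewrite -mulmxA -row_permE mul_diag_mx; apply/matrixP => k l.
rewrite !mxE (inj_eq perm_inj); case: (eqVneq k i) => [->|] //=.
by rewrite !mulr0.
Qed.

(** Two phase vectors are allowed because $D_u$ gets multiplied by $P$ on the left and by $Q^*$ on
    the right. *)
Lemma monomial_conj_delta d e s (i : 'I_n) :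
  monomial_mx d s *m delta_mx (s i) (s i) *m (monomial_mx e s) ^t* =
  (d 0 i * (e 0 i)^*) *: delta_mx i i.
Proof.
rewrite mul_monomial_delta -scalemxAl -[delta_mx i (s i)]trmxCK -mulmx_adj.
rewrite adj_delta_mx mul_monomial_delta linearZ /= map_mxZ adj_delta_mx.
by rewrite scalerA.
Qed.

Lemma diag_unitaryP (D : 'M[C]_n) : diag_unitary D ->
  exists2 d, D = diag_mx d & forall i, d 0 i * (d 0 i)^* = 1.
Proof.
move=> [/is_diag_mxP dD /unitarymxP uD].
have DE : D = diag_mx (\row_i D i i).
  apply/matrixP => i j; rewrite !mxE; case: eqVneq => [->//|ij].
  by rewrite mulr0n dD.
exists (\row_i D i i) => // i.
move: uD => /matrixP/(_ i i); rewrite !mxE eqxx (bigD1 i) //= big1 ?addr0.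
  by rewrite !mxE.
by move=> j ji; rewrite dD ?mul0r // eq_sym.
Qed.

Variables (d : 'rV[C]_n) (s : 'S_n).
Hypothesis d1 : forall i, d 0 i * (d 0 i)^* = 1.
Let P : 'M[C]_n := perm_mx s.
Let Q := monomial_mx d s.

Lemma unitary_monomial : Q \is unitarymx.
Proof.
apply: mul_unitarymx; last exact: unitary_perm_mx.
apply/unitarymxP; rewrite tr_diag_mx map_diag_mx mulmx_diag.
by apply/matrixP => i j; rewrite !mxE d1.
Qed.

(** Row [i] of [Q *m u] is $d_i$ times row [s i] of [u]. The product with $P$ and $Q^*$ moves the
    diagonal unit at [s i] to [i] and supplies the conjugate phase. *)
Lemma hadD_monomial u k :
  hadD (Q *m u) k =
  first_leg k.+1 P *m hadD u k *m first_leg k.+1 (Q ^t*).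
Proof.
rewrite /hadD -scalemxAr -scalemxAl; congr (_ *: _).
rewrite mulmx_sumr mulmx_suml [RHS](reindex_inj (@perm_inj _ s)).
apply: eq_bigr => i _; rewrite mulmx_sumr mulmx_suml; apply: eq_bigr => j _.
rewrite -scalemxAr -scalemxAl /first_leg !tensmx_mul mul1mx mulmx1.
have -> : P *m delta_mx (s i) (s i) *m Q ^t* = (d 0 i)^* *: delta_mx i i.
  by rewrite /P -monomial_mx1 monomial_conj_delta mxE mul1r.
rewrite tensmxZl scalerA /Q /monomial_mx -mulmxA -row_permE mul_diag_mx !mxE.
by rewrite rmorphM mulrC.
Qed.

Lemma first_leg_mul k c c' :
  first_leg k (c *m c') = first_leg k c *m first_leg k c'.
Proof. by rewrite /first_leg tensmx_mul mulmx1. Qed.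

Lemma first_leg_emb k c (x : 'M[C]_(tdim n k)) :
  first_leg k c *m emb x = emb x *m first_leg k c.
Proof. by rewrite /first_leg /emb !tensmx_mul !mul1mx !mulmx1. Qed.

Lemma emb_mul k (x y : 'M[C]_(tdim n k)) : emb (x *m y) = emb x *m emb y.
Proof. by rewrite /emb tensmx_mul mulmx1. Qed.

(** The even level is a hypothesis here because even and odd levels are treated in alternation. *)
Lemma had_odd_monomial u k :
  had_even (Q *m u) k = prod_unitary Q P k.+1 *m had_even u k ->
  had_odd (Q *m u) k =
  prod_unitary Q P k.+2 *m had_odd u k *m first_leg k.+1 (Q ^t*).
Proof.
move=> E; rewrite /had_odd E hadD_monomial emb_mul.
have -> : prod_unitary Q P k.+2 =
    emb (prod_unitary Q P k.+1) *m first_leg k.+1 P.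
  by rewrite /emb /first_leg tensmx_mul mul1mx mulmx1.
by rewrite -!mulmxA; congr (_ *m _); rewrite !mulmxA first_leg_emb.
Qed.

(** The factor $Q^*$ ending the odd unitary cancels the $Q$ of the [Q *m u] appended to it. *)
Lemma had_even_monomial u k :
  had_even (Q *m u) k = prod_unitary Q P k.+1 *m had_even u k.
Proof.
elim: k => [|k IH].
  by rewrite /= /first_leg tensmx_mul mulmx1.
have uE : Q ^t* *m (Q *m u) = u.
  by rewrite mulmxA (mulmx1C (unitarymxP unitary_monomial)) mul1mx.
by rewrite !had_evenS (had_odd_monomial IH) -mulmxA -first_leg_mul uE -mulmxA.
Qed.

Lemma vertex_diag_monomial u w k :
  vertex_diag (Q *m u) w k = prod_ad Q P @` vertex_diag u w k.
Proof.
rewrite /vertex_diag image_comp; apply: eq_imagel => c _ /=.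
rewrite (had_odd_monomial (had_even_monomial u k)).
set p := prod_unitary _ _ _; set f := first_leg _ _; set e := emb (had_even _ _).
set y := emb _; set o := had_odd _ _.
have fe : f *m e = e *m f by exact: first_leg_emb.
have fy : f *m y = y *m f by exact: first_leg_emb.
have ff : f *m f ^t* = 1%:M.
  rewrite /f /first_leg tensmx_adj tensmx_mul trmxCK adjmx1 mulmx1.
  by rewrite (mulmx1C (unitarymxP unitary_monomial)) tensmx11.
by rewrite /prod_ad -/p (conjmx_commuting _ _ fe fy ff).
Qed.

Lemma spin_diag_monomial u :
  spin_diag (Q *m u) = prod_ad Q P @` spin_diag u.
Proof.
rewrite /spin_diag image_comp; apply: eq_imagel => c _ /=.
rewrite /prod_ad /= /first_leg tensmx_adj !tensmx_mul !adjmx1 !mulmx1.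
by rewrite mulmx_adj !mulmxA.
Qed.

(** Beyond the first leg only [P] acts, and permuting rows and columns fixes the constant matrix.
    The phases of [Q] need not fix it, which is why $e_1$ is left out. *)
Lemma prod_ad_jones_odd k : prod_ad Q P (jones_odd K n k.+1) = jones_odd K n k.+1.
Proof.
rewrite /jones_odd prod_ad_top ?unitary_monomial ?unitary_perm_mx //.
rewrite -scalemxAr -scalemxAl; congr (first_leg _ (_ *: _)).
rewrite /P adj_perm_mx -row_permE -col_permE.
by apply/matrixP => i j; rewrite !mxE.
Qed.

(** Both legs permute the diagonal units in the same way; for [k = 0] the lower leg carries [Q],
    whose phases cancel on diagonal units. *)
Lemma prod_ad_jones_even k : prod_ad Q P (jones_even K n k) = jones_even K n k.
Proof.
rewrite /prod_ad /jones_even mulmx_sumr mulmx_suml (reindex_inj (@perm_inj _ s)).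
apply: eq_bigr => i _.
have PE : P *m delta_mx (s i) (s i) *m P ^t* = delta_mx i i.
  by rewrite /P -monomial_mx1 monomial_conj_delta !mxE conjC1 mulr1 scale1r.
have QE : Q *m delta_mx (s i) (s i) *m Q ^t* = delta_mx i i.
  by rewrite monomial_conj_delta d1 scale1r.
rewrite /= /first_leg !tensmx_adj !tensmx_mul PE mulmx1.
rewrite prod_unitaryK ?unitary_monomial ?unitary_perm_mx //.
by case: k => [|k]; rewrite ?PE ?QE.
Qed.

End MonomialMatrices.

(** * Product automorphisms of the hyperfinite factor *)

Section GNS.
Variables (K : realType) (n : nat) (H : hilbert K) (G : gns n H).
Local Notation C := (complex K).
Local Notation "''T_' k" := 'M[C]_(tdim n k) (at level 8, k at level 2).
Local Notation Omega := (cyclic_vector G).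
Local Notation "<[ x , y ]>" := (inner_prod H x y).
Implicit Types (A B : 'M[C]_n).

Lemma emb_unitary k (x : 'T_k) : x \is unitarymx -> emb x \is unitarymx.
Proof.
move=> /unitarymxP ux; apply/unitarymxP.
by rewrite /emb tensmx_adj tensmx_mul ux adjmx1 mulmx1 tensmx11.
Qed.

(** Matrices of different levels are compared by moving them to a common one; unitarity and the
    product action survive the move. *)
Lemma rep_lift k m (x : 'T_k) : (k <= m)%N -> exists x' : 'T_m,
  [/\ rep G m x' = rep G k x, x \is unitarymx -> x' \is unitarymx &
      forall A B, A \is unitarymx -> B \is unitarymx ->
      rep G m (prod_ad A B x') = rep G k (prod_ad A B x)].
Proof.
elim: m => [|m IH].
  by case: k x => // x _; exists x.
rewrite leq_eqVlt => /predU1P[km|/IH[x' [x'E ux' x'ad]]].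
  by move: x {IH}; rewrite km => x; exists x.
exists (emb x'); split; first by rewrite rep_emb.
  by move=> /ux'; exact: emb_unitary.
by move=> A B uA uB; rewrite prod_ad_emb // rep_emb x'ad.
Qed.

Lemma rep_inner k (x y : 'T_k) :
  <[rep G k x Omega, rep G k y Omega]> = \tr (y ^t* *m x) / (tdim n k)%:R.
Proof.
rewrite -(rep_trace G) rep_mul /=.
by have := rep_adjoint G (y ^t*) (rep G k x Omega) Omega; rewrite trmxCK => ->.
Qed.

Lemma rep_norm2 k (x : 'T_k) :
  `|rep G k x Omega| ^+ 2 = \tr (x ^t* *m x) / (tdim n k)%:R.
Proof. by rewrite inner_prod_norm rep_inner. Qed.

Lemma eq_norm2 (x y : H) : `|x| ^+ 2 = `|y| ^+ 2 -> `|x| = `|y|.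
Proof. by move/eqP; rewrite eqrXn2 // => /eqP. Qed.

Lemma norm_cyclic_vector : `|Omega| = 1.
Proof.
apply/eqP; rewrite -(@eqrXn2 _ 2) // expr1n inner_prod_norm.
have := rep_trace G (1%:M : 'T_0); rewrite rep_one /= => ->.
by rewrite mxtrace1 divr1.
Qed.

Lemma norm_adjoint_unitary (S T : H -> H) (x : H) :
  is_adjoint S T -> T \o S = idfun -> `|S x| = `|x|.
Proof.
move=> ST TS; apply: eq_norm2.
by rewrite !inner_prod_norm ST; have /= -> := congr1 (@^~ x) TS.
Qed.

Lemma norm_rep_unitary k (x : 'T_k) (z : H) :
  x \is unitarymx -> `|rep G k x z| = `|z|.
Proof.
move=> /unitarymxP ux; apply: norm_adjoint_unitary (rep_adjoint G x) _.
by rewrite -rep_mul (mulmx1C ux) rep_one.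
Qed.

Lemma norm_rep_mulr k (x y : 'T_k) : y \is unitarymx ->
  `|rep G k (x *m y) Omega| = `|rep G k x Omega|.
Proof.
move=> /unitarymxP uy; apply: eq_norm2; rewrite !rep_norm2; congr (_ / _).
by rewrite mulmx_adj -mulmxA mxtrace_mulC -!mulmxA uy mulmx1.
Qed.

Lemma norm_rep_ad A B k (x : 'T_k) : A \is unitarymx -> B \is unitarymx ->
  `|rep G k (prod_ad A B x) Omega| = `|rep G k x Omega|.
Proof.
move=> uA uB; apply: eq_norm2; rewrite !rep_norm2; congr (_ / _).
by rewrite prod_ad_adj -prod_adM // prod_ad_tr.
Qed.

(** The squared 2-norm is multiplicative on tensors, with [b] measured in the normalized trace of
    $M_n$. *)
Lemma norm_rep_tens b k (x : 'T_k) :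
  `|rep G k.+1 (b *t x) Omega| ^+ 2 =
  \tr (b ^t* *m b) / n%:R * `|rep G k x Omega| ^+ 2.
Proof.
rewrite !rep_norm2 tensmx_adj tensmx_mul mxtrace_tens natrM.
by rewrite mulf_div.
Qed.

(** The disjoint union of the levels indexes the dense subspace; a matrix and its embeddings give
    the same vector. *)
Definition gns_vector (a : {k & 'T_k}) : H := rep G _ (tagged a) Omega.

Lemma gns_vector_dense : closure (range gns_vector) = setT.
Proof.
rewrite -(rep_cyclic G); congr closure; rewrite eqEsubset; split => z.
  by move=> [[k x] _ <-]; exists k, x.
by move=> [k [x ->]]; exists (Tagged (fun k => 'T_k) x).
Qed.

Lemma eq_on_gns_vector (f g : H -> H) : continuous f -> continuous g ->
  (forall k (x : 'T_k), f (rep G k x Omega) = g (rep G k x Omega)) -> f = g.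
Proof.
move=> cf cg fg; apply/funext => z; apply: (@eq_on_closure _ _ (range gns_vector)) => //.
  by move=> _ [[k x] _ <-]; exact: fg.
by rewrite gns_vector_dense.
Qed.

Lemma gns_isometry A B : A \is unitarymx -> B \is unitarymx ->
  exists U : H -> H, [/\ linear U, forall x, `|U x| = `|x| &
    forall k (x : 'T_k), U (rep G k x Omega) = rep G k (prod_ad A B x) Omega].
Proof.
move=> uA uB.
pose q (a : {k & 'T_k}) : H := rep G _ (prod_ad A B (tagged a)) Omega.
have [||U [lU Uq iU]] := @isometry_extension_linear C H H _ gns_vector q _ _
    gns_vector_dense.
- move=> c [k x] [l y]; rewrite /q /gns_vector /=.
  have [x' [xE _ xad]] := rep_lift x (leq_addr l k).
  have [y' [yE _ yad]] := rep_lift y (leq_addl k l).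
  exists (Tagged (fun k => 'T_k) (c *: x' + y')) => /=.
  rewrite prod_adD prod_adZ !rep_add !rep_scale.
  by rewrite -xE -yE -(xad A B uA uB) -(yad A B uA uB).
- by move=> [k x]; exact: norm_rep_ad.
exists U; split=> // k x.
exact: (Uq (Tagged (fun k => 'T_k) x)).
Qed.

Lemma linear_isometry_bounded (U : H -> H) :
  linear U -> (forall x, `|U x| = `|x|) -> bounded_operators U.
Proof.
move=> lU iU; split => //; apply: isometry_continuous => a b.
by rewrite -(iU (a - b)) (linear_mapD lU) -(scaleN1r b) (linear_mapZ lU) scaleN1r.
Qed.

(** [V] is the extension for the adjoint matrices; [U] and [V] are mutually inverse on the dense
    vectors, hence everywhere. *)
Lemma gns_spatial A B : A \is unitarymx -> B \is unitarymx ->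
  exists U V : H -> H, unitary_pair U V /\
    forall k (x : 'T_k), conj_op U V (rep G k x) = rep G k (prod_ad A B x).
Proof.
move=> uA uB.
have uA' : A ^t* \is unitarymx by rewrite trmxC_unitary.
have uB' : B ^t* \is unitarymx by rewrite trmxC_unitary.
have [U [lU iU Ux]] := gns_isometry uA uB.
have [V [lV iV Vx]] := gns_isometry uA' uB'.
have bU := linear_isometry_bounded lU iU.
have bV := linear_isometry_bounded lV iV.
have adK k (x : 'T_k) : prod_ad A B (prod_ad (A ^t*) (B ^t*) x) = x.
  by rewrite prod_ad_comp (unitarymxP uA) (unitarymxP uB) prod_ad1.
have adVK k (x : 'T_k) : prod_ad (A ^t*) (B ^t*) (prod_ad A B x) = x.
  by rewrite prod_ad_comp (mulmx1C (unitarymxP uA)) (mulmx1C (unitarymxP uB)) prod_ad1.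
have UV : U \o V = idfun.
  apply: eq_on_gns_vector; first exact: (bounded_comp bU bV).2.
    by move=> x; exact: cvg_id.
  by move=> k x /=; rewrite Vx Ux adK.
have VU : V \o U = idfun.
  apply: eq_on_gns_vector; first exact: (bounded_comp bV bU).2.
    by move=> x; exact: cvg_id.
  by move=> k x /=; rewrite Ux Vx adVK.
exists U, V; split.
  (* For the adjoint relation, [y] is written as [U (V y)] and [U] preserves inner products. *)
  split => // x y; rewrite -[in LHS](congr1 (@^~ y) UV : U (V y) = y).
  exact: linear_isometry_inner.
move=> k x; apply: eq_on_gns_vector.
- exact: (bounded_conj bU bV (rep_bounded G x)).2.
- exact: (rep_bounded G _).2.
move=> l y; rewrite /conj_op /= Vx.
(* At a common level the identity to check is
   $\mathrm{Ad}(x\,\mathrm{Ad}^{-1}(y))=\mathrm{Ad}(x)\,y$. *)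
have [x' [xE _ xad]] := rep_lift x (leq_addr l k).
have [y' [yE _ yad]] := rep_lift y (leq_addl k l).
rewrite -xE -(yad _ _ uA' uB') -(xad _ _ uA uB) -yE.
have mulE (a b : 'T_(k + l)) z : rep G _ a (rep G _ b z) = rep G _ (a *m b) z.
  by rewrite rep_mul.
by rewrite !mulE Ux prod_adM // adK.
Qed.

(** * Inner and outer product actions on the hyperfinite factor *)

Lemma hyperfinite_rep k (x : 'T_k) : hyperfinite G (rep G k x).
Proof.
split; first exact: rep_bounded.
have xN : (\bigcup_k range (rep G k)) (rep G k x) by exists k.
by have := @subset_closure {ptws H -> H} _ _ xN.
Qed.

Lemma hyperfinite_conj A B U V : unitary_pair U V ->
  (forall k (x : 'T_k), conj_op U V (rep G k x) = rep G k (prod_ad A B x)) ->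
  forall T, hyperfinite G T -> hyperfinite G (conj_op U V T).
Proof.
move=> [bU bV _ _ _] UVx T hT.
apply: strong_closureS (strong_closure_conj bU bV hT).
by move=> _ [_ [k _ [x _ <-]] <-]; exists k => //; rewrite UVx.
Qed.

Lemma rep_first_leg0 A k :
  rep G k.+1 (prod_unitary A 1%:M k.+1) = rep G 1 (first_leg 0 A).
Proof.
elim: k => [//|k IH]; rewrite -IH.
exact: (rep_emb G (prod_unitary A 1%:M k.+1)).
Qed.

(** With trivial action on the later legs, the product action is conjugation by [A] on the first
    leg: first on matrices, then on strong limits. *)
Lemma inner_prod_ad A U V : A \is unitarymx -> continuous U ->
  (forall k (x : 'T_k), conj_op U V (rep G k x) = rep G k (prod_ad A 1%:M x)) ->
  inner (hyperfinite G) (conj_op U V).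
Proof.
move=> uA cU UVx.
have fU : first_leg 0 A *m (first_leg 0 A) ^t* = 1%:M.
  by rewrite /first_leg tensmx_adj tensmx_mul (unitarymxP uA) adjmx1 mulmx1 tensmx11.
exists (rep G 1 (first_leg 0 A)), (rep G 1 ((first_leg 0 A) ^t*)); split.
- exact: hyperfinite_rep.
- exact: rep_adjoint.
- by rewrite -rep_mul fU rep_one.
- by rewrite -rep_mul (mulmx1C fU) rep_one.
move=> T hT; apply: (strong_closure_eq cU _ _ hT).
  exact: (rep_bounded G _).2.
move=> _ [k _ [x _ <-]]; rewrite UVx.
(* One level up, so that a first leg exists even for [k = 0]. *)
have [x' [xE _ xad]] := rep_lift x (leqnSn k).
rewrite -xE -(xad _ _ uA (unitarymx1 _ n)) /prod_ad !rep_mul.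
by rewrite prod_unitary_adj adjmx1 !rep_first_leg0 /conj_op /first_leg tensmx_adj adjmx1.
Qed.

(* Traciality: right multiplication by a unitary is isometric in the 2-norm on
   each M_n^{(l)}, and so, by strong continuity, on the whole of [hyperfinite]. *)
Lemma norm_hyperfinite_mulr k (x y : 'T_k) T : hyperfinite G T ->
  y \is unitarymx ->
  `|T (rep G k y Omega) - rep G k x (rep G k y Omega)| =
  `|T Omega - rep G k x Omega|.
Proof.
move=> [_ clT] uy.
have cont z z' : continuous (fun S : {ptws H -> H} => `|S z - z'|).
  have cn : continuous (fun t : H => `|t - z'|).
    by move=> t; apply: cvg_norm; apply: cvgB; [exact: cvg_id|exact: cvg_cst].
  move=> S; apply: (@continuous_comp _ _ _ (fun S : {ptws H -> H} => S z : H)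
    (fun t : H => `|t - z'|)); last exact: cn.
  exact: ptws_eval_continuous.
have := eq_on_closure _ (cont (rep G k y Omega) (rep G k x (rep G k y Omega)))
  (cont Omega (rep G k x Omega)) _ clT; apply => //.
move=> _ [l _ [z _ <-]].
have [x' [<- _ _]] := rep_lift x (leq_addr l k).
have [y' [<- uy' _]] := rep_lift y (leq_addr l k).
have [z' [<- _ _]] := rep_lift z (leq_addl k l).
have mulE (a b : 'T_(k + l)) w : rep G _ a (rep G _ b w) = rep G _ (a *m b) w.
  by rewrite rep_mul.
have subE (a b : 'T_(k + l)) w : rep G _ a w - rep G _ b w = rep G _ (a - b) w.
  by rewrite rep_add -[- b]scaleN1r rep_scale -scaleN1r.
by rewrite !mulE !subE -mulmxBl norm_rep_mulr // uy'.
Qed.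


(** A level of at least one ensures that the next leg is acted on by the permutation and not by the
    first-leg unitary. *)
Lemma hyperfinite_approx T (e : C) : hyperfinite G T -> 0 < e ->
  exists k (x : 'T_k.+1), `|T Omega - rep G _ x Omega| < e.
Proof.
move=> [_ clT] e0.
have nT : nbhs (T : {ptws H -> H}) ((fun S => S Omega) @^-1` ball (T Omega) e).
  exact: (@ptws_eval_continuous K H Omega T _ (nbhsx_ballx _ _ e0)).
have [_ [[k _ [x _ <-]] xe]] := clT _ nT; move: xe.
rewrite /= -ball_normE /= => xe.
by have [x' [x'E _ _]] := rep_lift x (leqnSn k); exists k, x'; rewrite x'E.
Qed.

(** The squared 2-norm of $(c-c')\otimes x$ is at least $1/n$, since $c-c'$ is large and $x$ has
    2-norm at least $1/2$, but at most $1/(2n)^2$ by approximation. *)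
Lemma not_inner_prod_ad A (s : 'S_n) f : A \is unitarymx -> s != 1%g ->
  (forall k (x : 'T_k), f (rep G k x) = rep G k (prod_ad A (perm_mx s) x)) ->
  ~ inner (hyperfinite G) f.
Proof.
move=> uA s1 fx [U [V [hU UV _ VU fE]]].
have [i si] : exists i, s i != i.
  apply/existsP; apply: contraNT s1; rewrite negb_exists => /forallP si.
  by apply/eqP/permP => i; rewrite perm1; apply/eqP; rewrite -[_ == _]negbK.
have n0 : (0 < n)%N by exact: leq_ltn_trans (ltn_ord i).
have UVx k (x : 'T_k) z : U (rep G k x z) = rep G k (prod_ad A (perm_mx s) x) (U z).
  rewrite -fx fE; last exact: hyperfinite_rep.
  by rewrite /= (congr1 (@^~ z) VU : V (U z) = z).
(* As [s] moves [i], the matrix [c] and its conjugate [c'] have opposite signs in entry [i]; this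
   entry alone contributes 4 to the trace in [t]. *)
pose e : 'rV[C]_n := \row_l (if l == i then -1 else 1).
pose c : 'M[C]_n := diag_mx e.
pose c' : 'M[C]_n := diag_mx (\row_l e 0 (s l)).
have uc : c \is unitarymx.
  apply/unitarymxP; rewrite tr_diag_mx map_diag_mx mulmx_diag.
  apply/matrixP => k l; rewrite !mxE; case: (k == l) => //; case: ifP => _.
    by rewrite rmorphN rmorph1 mulrNN mulr1.
  by rewrite rmorph1 mulr1.
have cc' : perm_mx s *m c *m (perm_mx s) ^t* = c'.
  rewrite adj_perm_mx -row_permE -col_permE; apply/matrixP => k l.
  by rewrite !mxE (inj_eq perm_inj).
have uc' : c' \is unitarymx.
  by rewrite -cc' !mul_unitarymx ?trmxC_unitary ?unitary_perm_mx.
set t := \tr ((c - c') ^t* *m (c - c')) / n%:R.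
have t_ge : 4 / n%:R <= t.
  rewrite ler_pM2r ?invr_gt0 ?ltr0n // /c /c' -linearB /=.
  rewrite tr_diag_mx map_diag_mx mulmx_diag mxtrace_diag (bigD1 i) //= !mxE.
  rewrite eqxx (negPf si) -[leLHS]addr0 lerD //.
    by rewrite -opprD rmorphN mulrNN -normCKC -mulr2n normr_nat -natrX.
  by apply: sumr_ge0 => l _; rewrite !mxE -normCKC exprn_ge0.
(* With $\varepsilon=1/(4n)$, the square of $2\varepsilon=1/(2n)$ is below $1/n$, and
   $\varepsilon\le1/2$ keeps $\|x\Omega\|\ge1/2$. *)
have eps_gt0 : 0 < (4 * n%:R)^-1 :> C by rewrite invr_gt0 -natrM ltr0n muln_gt0.
have [k [x xU]] := hyperfinite_approx hU eps_gt0.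
set eps : C := _^-1 in eps_gt0 xU.
pose a := first_leg k.+1 c; pose a' := first_leg k.+1 c'.
have ua : a \is unitarymx.
  apply/unitarymxP.
  by rewrite tensmx_adj tensmx_mul adjmx1 mulmx1 (unitarymxP uc) tensmx11.
have ua' : a' \is unitarymx.
  apply/unitarymxP.
  by rewrite tensmx_adj tensmx_mul adjmx1 mulmx1 (unitarymxP uc') tensmx11.
have Ua : U (rep G _ a Omega) = rep G _ a' (U Omega).
  by rewrite UVx prod_ad_top ?unitary_perm_mx // cc'.
pose y := rep G k.+2 ((c - c') *t x) Omega.
(* As [emb x] commutes with [a], the vector [y] measures the failure of [x] to intertwine [a] and
   [a'] in the way [U] does. *)
have yE : y = rep G _ (emb x) (rep G _ a Omega) - rep G _ a' (rep G _ (emb x) Omega).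
  have mulE (p q : 'T_k.+2) w : rep G _ p (rep G _ q w) = rep G _ (p *m q) w.
    by rewrite rep_mul.
  rewrite !mulE /a /a' /first_leg /emb !tensmx_mul !mulmx1 !mul1mx /y.
  have -> : (c - c') *t x = c *t x + (-1) *: (c' *t x).
    by apply/matrixP => p q; rewrite !mxE mulrBl mulN1r.
  rewrite rep_add rep_scale.
  exact: (congr1 (fun z => _ + z) (scaleN1r _)).
have y_le : `|y| <= eps + eps.
  (* Insert $Ua\Omega=a'U\Omega$: the first difference is small by traciality, the second because
     [a'] is unitary. *)
  have -> : y = - (U (rep G _ a Omega) - rep G _ (emb x) (rep G _ a Omega)) +
      rep G _ a' (U Omega - rep G _ (emb x) Omega).
    rewrite (linear_mapD (rep_bounded G a').1).
    rewrite -(scaleN1r (rep G _ (emb x) Omega)) (linear_mapZ (rep_bounded G a').1).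
    by rewrite scaleN1r yE Ua opprB addrA subrK.
  apply: le_trans (ler_normD _ _) _.
  rewrite normrN norm_hyperfinite_mulr // norm_rep_unitary // rep_emb.
  by apply: lerD; exact: ltW.
have nU : `|U Omega| = 1.
  by rewrite (norm_adjoint_unitary _ UV VU) norm_cyclic_vector.
have x_ge : 2^-1 <= `|rep G _ x Omega|.
  have := le_lt_trans (lerB_dist _ _) xU; rewrite nU ltrBlDr => /ltW x1.
  rewrite -(lerD2l eps) (le_trans _ x1) // [leRHS](splitr 1) mul1r lerD2r.
  rewrite lef_pV2 ?posrE ?mulr_gt0 ?ltr0n // -natrM ler_nat.
  by rewrite (leq_trans (isT : (2 <= 4)%N)) ?leq_pmulr.
have : n%:R^-1 <= `|y| ^+ 2.
  rewrite norm_rep_tens -/t.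
  have -> : n%:R^-1 = 4 / n%:R * 2^-1 ^+ 2 :> C.
    rewrite mulrAC exprVn -natrX [X in X / _](_ : _ = 1) ?mul1r //.
    by apply: divff; rewrite pnatr_eq0.
  by apply: ler_pM => //; rewrite ?lerXn2r ?nnegrE ?divr_ge0 ?exprn_ge0 ?invr_ge0 ?ler0n.
apply/negP; rewrite -real_ltNge ?ger0_real ?exprn_ge0 ?invr_ge0 //.
have epsD : eps + eps = (2 * n%:R)^-1.
  have -> : eps = (2 * n%:R)^-1 / 2.
    rewrite /eps [X in (X * _)^-1](_ : _ = 2 * 2) -?natrM //.
    by rewrite -mulnA natrM invfM mulrC.
  by rewrite -splitr.
apply: (@le_lt_trans _ _ ((2 * n%:R)^-1 ^+ 2)).
  by rewrite -epsD lerXn2r ?nnegrE // addr_ge0 // ltW.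
rewrite exprVn -natrM -natrX ltf_pV2 ?posrE ?ltr0n ?expn_gt0 ?muln_gt0 ?n0 //.
rewrite ltr_nat (leq_trans (ltn_Pmull (isT : (1 < 2)%N) n0)) // expnS expn1.
by rewrite leq_pmulr ?muln_gt0.
Qed.

End GNS.

(** * Powers of the product automorphism and its outer period *)

Section InfiniteProduct.
Variables (K : realType) (n : nat) (H : hilbert K) (G : gns n H).
Local Notation C := (complex K).
Local Notation "''T_' k" := 'M[C]_(tdim n k) (at level 8, k at level 2).

(** The first-leg unitary of the power stays anonymous: innerness depends on the permutation
    alone. *)
Lemma iter_prod_ad (A : 'M[C]_n) (s : 'S_n) f m : A \is unitarymx ->
  (forall k (x : 'T_k), f (rep G k x) = rep G k (prod_ad A (perm_mx s) x)) ->
  exists2 A', A' \is unitarymx & forall k (x : 'T_k),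
    iter m f (rep G k x) = rep G k (prod_ad A' (perm_mx (s ^+ m)%g) x).
Proof.
move=> uA fx; elim: m => [|m [A' uA' IH]].
  exists 1%:M; first exact: unitarymx1.
  by move=> k x; rewrite expg0 perm_mx1 prod_ad1.
exists (A *m A'); first exact: mul_unitarymx.
by move=> k x; rewrite iterS IH fx prod_ad_comp expgS perm_mxM.
Qed.

Variables (Q : 'M[C]_n) (s : 'S_n) (U V : H -> H).
Hypothesis uQ : Q \is unitarymx.
Hypothesis UV : unitary_pair U V.
Hypothesis UVx : forall k (x : 'T_k),
  conj_op U V (rep G k x) = rep G k (prod_ad Q (perm_mx s) x).

Lemma conj_op_inv k (x : 'T_k) :
  conj_op V U (rep G k x) = rep G k (prod_ad (Q ^t*) (perm_mx s^-1) x).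
Proof.
have [_ _ _ _ VU] := UV.
rewrite -[RHS](conj_opK _ VU) UVx prod_ad_comp (unitarymxP uQ).
by rewrite -adj_perm_mx (unitarymxP (unitary_perm_mx _ s)) prod_ad1.
Qed.

Definition product_automorphism : automorphism (hyperfinite G) :=
  spatial_automorphism UV (hyperfinite_conj UV UVx)
    (hyperfinite_conj (unitary_pair_sym UV) conj_op_inv).

Lemma iter_continuous (W : H -> H) m : continuous W -> continuous (iter m W).
Proof.
move=> cW; elim: m => [|m IH] x; first exact: cvg_id.
by apply: continuous_comp; [exact: IH|exact: cW].
Qed.

(** Stated for an arbitrary pair, so that it serves both the automorphism and its inverse. *)
Lemma inner_iter_prod_ad (A : 'M[C]_n) (t : 'S_n) U' V' m :
  A \is unitarymx -> continuous U' ->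
  (forall k (x : 'T_k),
    conj_op U' V' (rep G k x) = rep G k (prod_ad A (perm_mx t) x)) ->
  inner (hyperfinite G) (iter m (conj_op U' V')) <-> (t ^+ m == 1)%g.
Proof.
move=> uA cU' U'x.
have [A' uA' itx] := iter_prod_ad m uA U'x; split.
  by move=> inn; apply: contraT => tm; case: (not_inner_prod_ad uA' tm itx inn).
move=> /eqP tm; rewrite (_ : iter m _ = conj_op (iter m U') (iter m V')).
  apply: (inner_prod_ad (A := A')) => //; first exact: iter_continuous.
  by move=> k x; rewrite -iter_conj_op itx tm perm_mx1.
by apply/funext => T; exact: iter_conj_op.
Qed.

Lemma inner_product_automorphism (j : int) :
  inner (hyperfinite G) (aut_pow product_automorphism j) <-> (#[s]%g %| `|j|)%N.
Proof.
have [bU bV _ _ _] := UV; rewrite order_dvdn; case: j => m.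
  exact: inner_iter_prod_ad bU.2 UVx.
(* [Negz m] stands for $-(m+1)$: the inverse is iterated, with permutation $s^{-1}$. *)
have uQ' : Q ^t* \is unitarymx by rewrite trmxC_unitary.
have -> : (s ^+ m.+1 == 1)%g = ((s^-1) ^+ m.+1 == 1)%g by rewrite expgVn invg_eq1.
exact: inner_iter_prod_ad bV.2 conj_op_inv.
Qed.

(** The exponents of inner powers are the multiples of [#[s]]; a positive [p] with the same
    multiples equals it, by divisibility in both directions. *)
Lemma outer_period_product_automorphism :
  outer_period product_automorphism = #[s]%g.
Proof.
have sP : [set j : int | inner (hyperfinite G) (aut_pow product_automorphism j)] =
    range (fun m : int => #[s]%g%:Z * m).
  rewrite eqEsubset; split => j /=.
    move/inner_product_automorphism => /(@dvdzP #[s]%g j) [q ->].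
    by exists q => //; rewrite mulrC.
  move=> [q _ <-]; apply/inner_product_automorphism.
  by rewrite abszM dvdn_mulr.
(* The default value 0 does not arise by lack of a period, since [#[s]] is itself admissible. *)
rewrite /outer_period; case: xgetP => [p _ [p0 pP]|/(_ #[s]%g)]; last first.
  by case; split.
apply/eqP; rewrite eqn_dvd; apply/andP; split.
  have : range (fun m : int => p%:Z * m) (#[s]%g : int).
    by rewrite -pP sP; exists 1; rewrite // mulr1.
  move=> [q _ /(congr1 absz)]; rewrite abszM => pq.
  apply/dvdnP; exists `|q|%N; rewrite mulnC; exact/esym.
apply/(inner_product_automorphism p); suff : range (fun m : int => p%:Z * m) p.
  by rewrite -pP.
by exists 1; rewrite // mulr1.
Qed.

End InfiniteProduct.

(** With $Q_i=D_iP_i$, the matrix sought is $Q_2Q_1^*$; moving the phases of $D_1^*$ through the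
    permutation evaluates them at its values. *)
Lemma monomial_quotient (K : realType) (n : nat)
    (W : 'M[complex K]_n) (d1 d2 : 'rV[complex K]_n) (s1 s2 : 'S_n) :
  (forall i, d1 0 i * (d1 0 i)^* = 1) -> (forall i, d2 0 i * (d2 0 i)^* = 1) ->
  exists2 d : 'rV[complex K]_n, (forall i, d 0 i * (d 0 i)^* = 1) &
    monomial_mx d2 s2 *m W =
    monomial_mx d (s2 * s1^-1)%g *m (monomial_mx d1 s1 *m W).
Proof.
move=> u1 u2; exists (\row_i (d2 0 i * (d1 0 ((s2 * s1^-1)%g i))^*)).
  move=> i; rewrite !mxE rmorphM /= conjCK mulrACA u2 mul1r mulrC; exact: u1.
rewrite mulmxA; congr (_ *m W).
rewrite /monomial_mx -[RHS]mulmxA -!row_permE; apply/matrixP => i j.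
rewrite !mul_diag_mx !mxE mulrA -[_ * d1 _ _]mulrA [_^* * _]mulrC u1 mulr1.
by rewrite permM permKV.
Qed.


(** * The isomorphism of the two chains *)

Theorem theorem5p2 (K : realType) (n : nat) (hn : (2 <= n)%N)
    (H : hilbert K) (G : gns n H)
    (u v W w D1 D2 P1 P2 : 'M[complex K]_n)
    (hu : complex_hadamard u) (hv : complex_hadamard v)
    (huv : hadamard_equiv u v) (uv : u <> v)
    (hW : complex_hadamard W)
    (hD1 : diag_unitary D1) (hD2 : diag_unitary D2)
    (hP1 : is_perm_mx P1) (hP2 : is_perm_mx P2)
    (uE : u = D1 *m P1 *m W) (vE : v = D2 *m P2 *m W)
    (hw : complex_hadamard w) :
  exists theta : automorphism (hyperfinite G),
    [/\ theta @` spin_subfactor G u = spin_subfactor G v,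
        forall k : nat,
          theta @` vertex_subfactor G u w k = vertex_subfactor G v w k,
        outer theta <-> P1 <> P2
      & P1 <> P2 -> exists2 s : 'S_n, P2 *m P1 ^t* = perm_mx s
                                    & outer_period theta = #[s]%g].

Proof.
have /is_perm_mxP[s1 P1E] := hP1; have /is_perm_mxP[s2 P2E] := hP2.
have [d1 D1E u1] := diag_unitaryP hD1; have [d2 D2E u2] := diag_unitaryP hD2.
have [d ud vuE] := monomial_quotient W s1 s2 u1 u2.
set s := (s2 * s1^-1)%g in vuE.
have {}vE : v = monomial_mx d s *m u by rewrite vE uE P1E P2E D1E D2E.
have sE : s = 1%g <-> P1 = P2.
  rewrite P1E P2E; split => [/eqP|/matrixP s12].
    by rewrite /s -eq_mulgV1 => /eqP ->.
  apply/eqP; rewrite -eq_mulgV1; apply/eqP/permP => i.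
  move: (s12 i (s1 i)); rewrite !mxE eqxx => /esym/eqP.
  by rewrite pnatr_eq1 eqb1 => /eqP.
have uQ := unitary_monomial s ud.
have [U [V [UV UVx]]] := gns_spatial G uQ (unitary_perm_mx _ s).
have UVj j : (2 <= j)%N -> conj_op U V (jones G j) = jones G j.
  rewrite /jones; case: ifP => oj j2; rewrite UVx.
    (* Here [j] is odd and at least 2, hence at least 3, so $e_1$ never occurs. *)
    have -> : j./2 = j./2.-1.+1 by rewrite prednK // half_gt0.
    by rewrite prod_ad_jones_odd.
  by rewrite prod_ad_jones_even.
pose theta := product_automorphism uQ UV UVx; exists theta; split.
- apply: conj_op_vn_generated => //; rewrite image_setU; congr (_ `|` _).
    rewrite vE spin_diag_monomial // !image_comp; apply: eq_imagel => x _.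
    exact: UVx.
  by rewrite image_comp; apply: eq_imagel => j /= /UVj.
- move=> k; apply: conj_op_vn_generated => //; rewrite image_setU; congr (_ `|` _).
    rewrite vE vertex_diag_monomial // !image_comp; apply: eq_imagel => x _.
    exact: UVx.
  rewrite image_comp; apply: eq_imagel => j /= j1; apply: UVj.
  by rewrite -addnA (leq_trans _ (leq_addl _ _)) // leq_addr.
(* Outerness concerns the first power: [theta] is inner exactly when the order of [s] divides 1. *)
- rewrite /outer (inner_product_automorphism uQ UV UVx 1) dvdn1 order_eq1.
  by split=> [/negP s1' /sE/eqP|P12 /eqP/sE//]; apply/negP.
- move=> _; exists s; last exact: outer_period_product_automorphism.
  by rewrite P1E P2E adj_perm_mx -perm_mxM.
Qed.
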